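(* Let $2\leq m<n$ be integers. Then the resultant of $\Psi_m(x,y)$ and $\Psi_n(x,y)$ with respect to $x$ is $$\begin{cases} p^{\varphi(m)}\,y^{\varphi(m)\varphi(n)}&\text{if } n/m=p^\alpha \text{ for some prime } p \text{ and some positive integer } \alpha;\\ y^{\varphi(m)\varphi(n)}&\text{otherwise}. \end{cases}$$
   Context: The Fibonacci polynomials are defined by $F_1(x)=1$, $F_2(x)=x$, and $F_n(x)=xF_{n-1}(x)+F_{n-2}(x)$ for $n\geq 3$. For $n\geq 2$, the $n$-th fibotomic polynomial $\Psi_n(x)\in\mathbb{Z}[x]$ is the product of the monic irreducible factors of $F_n(x)$ which are not factors of $F_k(x)$ for any $k<n$; also $\Psi_1(x)=1$. Thus $F_n(x)=\prod_{d\mid n}\Psi_d(x)$ for all $n\geq1$, and for $n\geq 2$, $\Psi_n(x)$ is monic of degree $\varphi(n)$, where $\varphi$ is Euler's totient function. The homogenized fibotomic polynomials are $\Psi_1(x,y)=1$ and $\Psi_n(x,y)=y^{\varphi(n)}\Psi_n(x/y)$ for $n\geq2$; these are homogeneous of degree $\varphi(n)$ and monic in $x$. For monic polynomials $f,g$ (in $x$) with roots $a_1,\dots,a_r$ and $b_1,\dots,b_s$ respectively, the resultant is $\textup{res}(f,g)=\prod_{i,j}(a_i-b_j)$. *)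

(* Defs.v *)
From HB Require Import structures.
From mathcomp Require Import all_boot all_order all_algebra.
Set Implicit Arguments. Unset Strict Implicit. Unset Printing Implicit Defensive.
Import Order.TTheory GRing.Theory Num.Theory.
Local Open Scope ring_scope.

Fixpoint fibp_aux (n : nat) : {poly int} * {poly int} :=
  match n with
  | 0 => (0, 1)
  | k.+1 => let: (a, b) := fibp_aux k in (b, 'X * b + a)
  end.
Definition fibp (n : nat) : {poly int} := (fibp_aux n).1.

(* P is the n-th fibotomic polynomial (n >= 2): P is the product of the monic
   irreducible factors of F_n (each taken once) which do not divide any F_k,
   1 <= k < n.  Stated literally: P is monic, squarefree, and its monic
   irreducible divisors are exactly those monic irreducible q dividing F_n
   but no F_k with 1 <= k < n. *)
Definition fibotomic (n : nat) (P : {poly int}) : Prop :=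
  P \is monic /\
  forall q : {poly int}, q \is monic -> irreducible_poly q ->
    (q %| P) = ((q %| fibp n) && [forall k : 'I_n, (0 < (k : nat))%N ==> ~~ (q %| fibp k)])
    /\ ~~ (q * q %| P).

(* Homogenization of degree d: P(x,y) = y^d P(x/y), as a polynomial in x
   (outer variable) with coefficients in Z[y]. *)
Definition homog (d : nat) (P : {poly int}) : {poly {poly int}} :=
  \poly_(i < d.+1) ((P`_i)%:P * 'X^(d - i)).

(* Main.v *)
Require Import Defs.
From HB Require Import structures.
From mathcomp Require Import all_boot all_order all_algebra all_field.
From mathcomp Require Import ring.
Import Order.TTheory GRing.Theory Num.Theory.
Local Open Scope ring_scope.

(* Say that x has rank d if F_j(x) = 0 iff d divides j. The roots of Psi_n are
   the numbers of rank n, and the resultant is, up to a power of y,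
   the product N of the differences b - a with a of rank m and b of rank n.
   Modulo F_l, the quotient F_(kl) / F_l is k times a unit. Hence a - b divides
   every prime p with different valuations in m and n, so that a - b is a unit
   among the algebraic integers if there are two such primes. If n = m p^k, then
   F_n / F_(n/p) takes at a a value that is p times a unit, and all of its
   factors a - x with x not of rank n are units. So N is known up to sign, and
   N >= 0 because numbers of rank n > 2 come in pairs of non-real conjugates. *)

Local Notation pZtoC := (map_poly (intr : int -> algC)).
Local Notation ev P x := (pZtoC P).[x].

(** * Fibonacci polynomial identities and congruences modulo [fibp l] *)

Lemma fibp0 : fibp 0 = 0. Proof. by []. Qed.
Lemma fibp1 : fibp 1 = 1. Proof. by []. Qed.
Lemma fibpSS n : fibp n.+2 = 'X * fibp n.+1 + fibp n.
Proof. by rewrite /fibp /=; case: (fibp_aux n). Qed.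

Lemma fibp_add a b :
  fibp (a + b).+1 = fibp a.+1 * fibp b.+1 + fibp a * fibp b.
Proof.
elim: a b => [|a IHa] b; first by rewrite fibp0 fibp1 mul0r addr0 mul1r.
by rewrite addSnnS IHa !fibpSS; ring.
Qed.

(** Cassini's identity, with F_(n+2) expanded by the recurrence; it is what makes F_(n+1) invertible
    modulo F_n. *)
Lemma fibp_cassini n :
  fibp n.+1 ^+ 2 = (-1) ^+ n + fibp n * ('X * fibp n.+1 + fibp n).
Proof.
elim: n => [|n IHn]; first by rewrite fibp0 fibp1; ring.
have Ds : (-1) ^+ n = fibp n.+1 ^+ 2 - fibp n * ('X * fibp n.+1 + fibp n).
  by rewrite IHn addrK.
by rewrite [(-1) ^+ n.+1]exprS Ds fibpSS; ring.
Qed.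

(** By the addition formula, adding l to the index multiplies F_(kl+1) by F_(l+1) modulo F_l. *)
Lemma fibpS_expr_mod l k : exists r, fibp (k * l).+1 = fibp l.+1 ^+ k + fibp l * r.
Proof.
elim: k => [|k [r IHk]]; first by exists 0; rewrite mul0n fibp1; ring.
exists (fibp l.+1 * r + fibp (k * l)).
by rewrite mulSn fibp_add IHk exprS; ring.
Qed.

(** The addition formula gives Q_(k+1) = F_(kl+1) + Q_k F_(l-1), and F_(l-1) is congruent to F_(l+1)
    modulo F_l. The extra factor F_(l+1) avoids the exponent k - 1. *)
Lemma fibp_quo_mod_aux l k :
  exists Q r, fibp (k * l) = fibp l * Q /\
    fibp l.+1 * Q = k%:R * fibp l.+1 ^+ k + fibp l * r.
Proof.
case: l => [|l].
  (* For l = 0 both [fibp l] and [fibp (k * l)] vanish, so only the second equation constrains Q; as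
     F_1 = 1, it reads Q = k. *)
  by exists k%:R, 0; rewrite muln0 fibp0 fibp1 expr1n; split; ring.
elim: k => [|k [Q [r [IHk Qr]]]].
  by exists 0, 0; rewrite mul0n fibp0 mulr0n !mulr0 mul0r addr0.
have [s Ds] := fibpS_expr_mod l.+1 k.
exists (fibp (k * l.+1).+1 + Q * fibp l),
  (fibp l.+2 * s + fibp l.+2 * r - 'X * fibp l.+2 * Q).
rewrite mulSnr addnS fibp_add IHk; split; first by ring.
have Dl : fibp l = fibp l.+2 - 'X * fibp l.+1 by rewrite fibpSS; ring.
rewrite (_ : _ * _ = fibp l.+2 * fibp (k * l.+1).+1 + (fibp l.+2 * Q) * fibp l.+2
  - 'X * fibp l.+1 * fibp l.+2 * Q); last by rewrite Dl; ring.
by rewrite Qr Ds -natr1 exprS; ring.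
Qed.

Lemma fibp_unit_mod l : exists V r, fibp l.+1 * V = 1 + fibp l * r.
Proof.
exists ((-1) ^+ l * fibp l.+1), ((-1) ^+ l * ('X * fibp l.+1 + fibp l)).
rewrite mulrCA -expr2 fibp_cassini mulrDr -exprMn mulrNN mulr1 expr1n.
by ring.
Qed.

(* Modulo [F_l], [F_(kl) / F_l = k F_(l+1)^(k-1)] and [F_(l+1)] is invertible. *)
Lemma fibp_quo_mod l k :
  exists Q U V r s, [/\ fibp (k * l) = fibp l * Q,
    U * Q = k%:R + fibp l * r & Q = k%:R * V + fibp l * s].
Proof.
have [Q [r [-> Qr]]] := fibp_quo_mod_aux l k; have [V [s Vs]] := fibp_unit_mod l.
have [t Dt] : exists t, fibp l.+1 ^+ k * V ^+ k = 1 + fibp l * t.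
  rewrite -exprMn Vs; elim: k {Qr} => [|k [t IHk]]; first by exists 0; ring.
  by exists (s + t + fibp l * s * t); rewrite exprS IHk; ring.
(* As [V] inverts F_(l+1) modulo F_l, the first two witnesses after [Q] stand for F_(l+1)^(1-k) and
   F_(l+1)^(k-1). *)
exists Q, (V ^+ k * fibp l.+1), (V * fibp l.+1 ^+ k), (k%:R * t + r * V ^+ k),
  (V * r - s * Q).
split=> //.
  have -> : V ^+ k * fibp l.+1 * Q = V ^+ k * (fibp l.+1 * Q) by ring.
  rewrite Qr; have -> : V ^+ k * (k%:R * fibp l.+1 ^+ k + fibp l * r) =
    k%:R * (fibp l.+1 ^+ k * V ^+ k) + fibp l * (r * V ^+ k) by ring.
  by rewrite Dt; ring.
have DQ : fibp l.+1 * V * Q = (1 + fibp l * s) * Q by rewrite Vs.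
rewrite [LHS](_ : _ = V * (fibp l.+1 * Q) - fibp l * s * Q); first by rewrite Qr; ring.
rewrite [X in _ = X - _](_ : _ = fibp l.+1 * V * Q); last by ring.
by rewrite DQ; ring.
Qed.

Lemma fibp_dvd_mul l k : exists Q, fibp (k * l) = fibp l * Q.
Proof. by have [Q [_ [_ [_ [_ [-> _ _]]]]]] := fibp_quo_mod l k; exists Q. Qed.

(** Write g = gcd(a, b) as u a - v b. The addition formula gives F_(ua) = F_(vb+1) F_g modulo
    F_(vb), and F_(vb+1) is invertible there; F_(ua) and F_(vb) are multiples of F_a and F_b. *)
Lemma fibp_gcd a b : (0 < a)%N ->
  exists U V, fibp (gcdn a b) = U * fibp a + V * fibp b.
Proof.
move=> a_gt0; case: (egcdnP b a_gt0) => u v Duv _.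
have [Qa Da] := fibp_dvd_mul a u; have [Qb Db] := fibp_dvd_mul b v.
move: (gcdn a b) Duv => [|g] Duv; first by exists 0, 0; rewrite fibp0; ring.
have [V [r Vr]] := fibp_unit_mod (v * b).
exists (V * Qa), (- Qb * (r * fibp g.+1 + V * fibp g)).
have Dg : fibp (u * a) = fibp (v * b).+1 * fibp g.+1 + fibp (v * b) * fibp g.
  by rewrite Duv addnS fibp_add.
have -> : V * Qa * fibp a = V * fibp (u * a) by rewrite Da; ring.
rewrite Dg mulrDr mulrA [V * _]mulrC Vr Db; ring.
Qed.

Lemma size_fibp n : size (fibp n) = n.
Proof.
suff [] : size (fibp n) = n /\ size (fibp n.+1) = n.+1 by [].
elim: n => [|n [IHn IHn1]]; first by rewrite fibp0 fibp1 size_poly0 size_poly1.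
have nzF : fibp n.+1 != 0 by rewrite -size_poly_eq0 IHn1.
by split=> //; rewrite fibpSS mulrC size_polyDl size_mulX ?IHn1 ?IHn.
Qed.

Lemma monic_fibp n : fibp n.+1 \is monic.
Proof.
elim: n => [|n IHn]; first exact: monic1.
rewrite fibpSS monicE lead_coefDl ?lead_coefM ?lead_coefX ?mul1r //.
by rewrite mulrC size_mulX ?monic_neq0 // !size_fibp.
Qed.

(** * Numbers of given rank and divisibility by their differences *)

Definition fib_rank (d : nat) (x : algC) :=
  forall j, (ev (fibp j) x == 0) = (d %| j)%N.

Lemma fib_rank_Aint d x : (0 < d)%N -> fib_rank d x -> x \in Aint.
Proof.
case: d => // d _ rk_x; apply: (@root_monic_Aint (pZtoC (fibp d.+1))).
- by rewrite /root rk_x.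
- by rewrite monic_map ?monic_fibp.
- by apply/polyOverP => i; rewrite coef_map /= rpred_int.
Qed.

Lemma Aint_evZ (P : {poly int}) x : x \in Aint -> ev P x \in Aint.
Proof.
move=> Ax; apply: rpred_horner => //.
by apply/polyOverP => i; rewrite coef_map /= Aint_int.
Qed.

Lemma evZ_sub (P : {poly int}) x y : x \in Aint -> y \in Aint ->
  exists2 w, w \in Aint & ev P x - ev P y = (x - y) * w.
Proof.
move=> Ax Ay; elim/poly_ind: P => [|P c [w Aw IHP]].
  by exists 0; rewrite ?rpred0 // rmorph0 !horner0 subrr mulr0.
exists (ev P x + y * w); first by rewrite rpredD ?rpredM ?Aint_evZ.
rewrite !(rmorphD, rmorphM) /= map_polyX map_polyC !hornerE.
by rewrite mulrDr mulrCA -IHP; ring.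
Qed.

(** If p did not divide m / gcd(m, d), the gcd would contain the full power of p in m, which is more
    than d contains. *)
Lemma dvdn_gcd_divp m d p : (0 < d)%N -> prime p ->
  (logn p d < logn p m)%N -> (p %| m)%N /\ (gcdn m d %| m %/ p)%N.
Proof.
move=> d_gt0 p_pr lt_dm; have := leq_ltn_trans (leq0n _) lt_dm.
rewrite logn_gt0 mem_primes => /and3P[_ m_gt0 p_dv_m]; split=> //.
have /dvdnP[k Dm] := dvdn_gcdl m d; have g_gt0 : (0 < gcdn m d)%N by rewrite gcdn_gt0 m_gt0.
have [/dvdnP[k2 Dk]|p'k] := boolP (p %| k)%N.
  by rewrite {2}Dm Dk mulnAC mulnK ?prime_gt0 // dvdn_mull.
have k_gt0 : (0 < k)%N by move: m_gt0; rewrite Dm muln_gt0 => /andP[].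
have le_gd : (logn p (gcdn m d) <= logn p d)%N by rewrite dvdn_leq_log ?dvdn_gcdr.
move: lt_dm; rewrite ltnNge {1}Dm lognM // lognE (negPf p'k) p_pr k_gt0 add0n.
by rewrite le_gd.
Qed.

(** Let l = m / p and F_m = F_l Q. Since F_m(a) = 0 and F_l(a) is nonzero, Q(a) = 0, so the
    congruence U Q = p modulo F_l makes F_l(a) divide p. With g = gcd(m, d), F_g(a) divides F_l(a),
    and F_g(a) is a multiple of F_d(a) = F_d(a) - F_d(b), hence of a - b. *)
Lemma fib_rank_sub_dvd_lt m d a b p : (0 < m)%N -> (0 < d)%N ->
    fib_rank m a -> fib_rank d b -> prime p -> (logn p d < logn p m)%N ->
  exists2 w, w \in Aint & p%:R = (a - b) * w.
Proof.
move=> m_gt0 d_gt0 rk_a rk_b p_pr lt_dm.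
have Aa := fib_rank_Aint _ _ m_gt0 rk_a; have Ab := fib_rank_Aint _ _ d_gt0 rk_b.
have [/divnK Dm /dvdnP[k Dl]] := dvdn_gcd_divp _ _ _ d_gt0 p_pr lt_dm.
set l := (m %/ p)%N in Dm Dl.
have [Q [U [_ [r [_ [DFm DQ _]]]]]] := fibp_quo_mod l p.
have [Q' DFl] := fibp_dvd_mul (gcdn m d) k.
have [U' [V' DFg]] := fibp_gcd m d m_gt0.
have [w Aw Dw] := evZ_sub (fibp d) _ _ Aa Ab.
have F0 : ev (fibp m) a = 0 by apply/eqP; rewrite rk_a.
have Fd0 : ev (fibp d) b = 0 by apply/eqP; rewrite rk_b.
have l_gt0 : (0 < l)%N by move: m_gt0; rewrite -Dm muln_gt0 => /andP[].
have nzFl : ev (fibp l) a != 0.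
  apply: contraTneq p_pr => /eqP; rewrite rk_a -Dm -{2}[l]muln1 dvdn_pmul2l //.
  by rewrite dvdn1 => /eqP->.
have Q0 : ev Q a = 0.
  apply/eqP; rewrite -(mulrI_eq0 _ (mulfI nzFl)) -hornerM -rmorphM -DFm mulnC Dm.
  by rewrite F0.
exists (- (w * ev V' a * ev Q' a * ev r a)).
  by rewrite rpredN !rpredM ?Aint_evZ.
move: Dw; rewrite Fd0 subr0 => Dw.
move/(congr1 (fun P => ev P a)): DQ; rewrite Dl DFl DFg.
rewrite !(rmorphD, rmorphM, rmorph_nat) /= -[p%:R]polyC_natr !(hornerD, hornerM).
rewrite hornerC Q0 mulr0 F0 mulr0 add0r Dw => /eqP.
by rewrite eq_sym addr_eq0 => /eqP ->; ring.
Qed.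

Lemma fib_rank_sub_dvd m d a b p : (0 < m)%N -> (0 < d)%N ->
    fib_rank m a -> fib_rank d b -> prime p -> logn p d != logn p m ->
  exists2 w, w \in Aint & p%:R = (a - b) * w.
Proof.
move=> m_gt0 d_gt0 rk_a rk_b p_pr; rewrite neq_ltn => /orP[lt_dm | lt_md].
  exact: (fib_rank_sub_dvd_lt m d).
have [w Aw ->] := fib_rank_sub_dvd_lt d m _ _ _ d_gt0 m_gt0 rk_b rk_a p_pr lt_md.
by exists (- w); rewrite ?rpredN // mulrN -mulNr opprB.
Qed.

(** The difference divides the two coprime integers p and q, hence also 1 by Bezout. *)
Lemma fib_rank_sub_unit m d a b p q : (0 < m)%N -> (0 < d)%N ->
    fib_rank m a -> fib_rank d b -> prime p -> prime q -> p != q ->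
    logn p d != logn p m -> logn q d != logn q m ->
  exists2 w, w \in Aint & (a - b) * w = 1.
Proof.
move=> m_gt0 d_gt0 rk_a rk_b p_pr q_pr neq_pq neq_p neq_q.
have [w1 Aw1 Dp] := fib_rank_sub_dvd _ _ _ _ _ m_gt0 d_gt0 rk_a rk_b p_pr neq_p.
have [w2 Aw2 Dq] := fib_rank_sub_dvd _ _ _ _ _ m_gt0 d_gt0 rk_a rk_b q_pr neq_q.
have [u v Duv _] := egcdnP q (prime_gt0 p_pr).
exists (u%:R * w1 - v%:R * w2); first by rewrite rpredB ?rpredM ?rpred_nat.
have : coprime p q by rewrite prime_coprime // dvdn_prime2.
move/eqP=> gcd1; move: Duv; rewrite gcd1 => /(congr1 (fun k => k%:R : algC)).
rewrite natrD !natrM Dp Dq => E.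
by rewrite mulrBr !(mulrCA (a - b)) E addrAC subrr add0r.
Qed.

(** * Explicit roots of the Fibonacci polynomials *)

(** Binet's formula: t and s are the roots of X^2 - x X - 1 with x = t + s, so their powers satisfy
    the Fibonacci recurrence. *)
Lemma fibp_binet (t s : algC) n : t * s = -1 ->
  (t - s) * ev (fibp n) (t + s) = t ^+ n - s ^+ n.
Proof.
move=> ts; suff [] : (t - s) * ev (fibp n) (t + s) = t ^+ n - s ^+ n /\
  (t - s) * ev (fibp n.+1) (t + s) = t ^+ n.+1 - s ^+ n.+1 by [].
elim: n => [|n [IHn IHn1]].
  by rewrite fibp0 fibp1 rmorph0 rmorph1 horner0 hornerC mulr0 mulr1 !expr0 subrr.
split=> //; rewrite fibpSS rmorphD rmorphM /= map_polyX hornerD hornerM hornerX.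
rewrite mulrDr IHn mulrCA IHn1 !exprS.
have -> : t * (t * t ^+ n) - s * (s * s ^+ n) = (t + s) * (t * t ^+ n - s * s ^+ n)
  - (t * s) * (t ^+ n - s ^+ n) by ring.
by rewrite ts; ring.
Qed.

(* When [z] is a primitive root of unity of order [2n], these are the roots
   [2 i cos (pi k / n)] of [F_n], up to reindexing. *)
Definition fib_root (z : algC) k := 'i * (z ^+ k + z ^- k).

Section FibRoots.

Variables (n : nat) (z : algC).
Hypothesis prim_z : n.*2.-primitive_root z.

Lemma fib_prim_neq0 : z != 0.
Proof.
apply/eqP => z0; have /eqP := prim_expr_order prim_z.
by rewrite z0 expr0n gtn_eqF ?(prim_order_gt0 prim_z) // eq_sym oner_eq0.
Qed.

(** By Binet's formula with t = i z^k and s = i z^(-k), F_j vanishes iff t^j = s^j, that is z^(2jk)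
    = 1, that is n divides j k. *)
Lemma fib_root_rank k : (0 < k < n)%N -> fib_rank (n %/ gcdn n k) (fib_root z k).
Proof.
case/andP=> k_gt0 lt_kn j; have n_gt0 : (0 < n)%N := leq_ltn_trans (leq0n k) lt_kn.
have nz_z := fib_prim_neq0.
have nz_zk : z ^+ k != 0 by rewrite expf_neq0.
pose t := 'i * z ^+ k; pose s := 'i * z ^- k.
have ts : t * s = -1 by rewrite /t /s mulrACA mulfV // mulr1 -expr2 sqrCi.
have eq_ts i : (t ^+ i == s ^+ i) = (n %| i * k)%N.
  rewrite !exprMn (inj_eq (mulfI (expf_neq0 _ (neq0Ci _)))) -exprVn -!exprM exprVn.
  rewrite -(inj_eq (mulIf (expf_neq0 (k * i) nz_z))) mulVf ?expf_neq0 //.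
  rewrite -exprD addnn -(prim_order_dvd prim_z) -!muln2 dvdn_pmul2r //.
  by rewrite mulnC.
have ts_neq0 : t - s != 0.
  rewrite subr_eq0 -[t]expr1 -[s]expr1 eq_ts mul1n; apply/negP => /(dvdn_leq k_gt0).
  by rewrite leqNgt lt_kn.
rewrite /fib_root mulrDr -(mulrI_eq0 _ (mulfI ts_neq0)) fibp_binet // subr_eq0 eq_ts.
have g_gt0 : (0 < gcdn n k)%N by rewrite gcdn_gt0 n_gt0.
have -> : (n %| j * k)%N =
    (n %/ gcdn n k * gcdn n k %| j * (k %/ gcdn n k * gcdn n k))%N.
  by rewrite !divnK ?dvdn_gcdl ?dvdn_gcdr.
rewrite mulnA dvdn_pmul2r //.
rewrite Gauss_dvdl // /coprime -(eqn_pmul2r g_gt0) mul1n muln_gcdl.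
by rewrite !divnK ?dvdn_gcdl ?dvdn_gcdr.
Qed.

Lemma fib_root_inj : {in gtn n &, injective (fib_root z)}.
Proof.
move=> k l; rewrite !inE => lt_kn lt_ln.
have nz_z := fib_prim_neq0.
have nzk : z ^+ k != 0 by rewrite expf_neq0.
have nzl : z ^+ l != 0 by rewrite expf_neq0.
move/(mulfI (neq0Ci _)) => /eqP; rewrite -subr_eq0.
(* By this factorization, equal values force z^k = z^l or z^(k+l) = 1; since k + l < 2n, the latter
   leaves only k = l = 0. *)
have -> : z ^+ k + z ^- k - (z ^+ l + z ^- l) =
  (z ^+ k - z ^+ l) * (z ^+ k * z ^+ l - 1) / (z ^+ k * z ^+ l).
  by field; rewrite nzk nzl.
rewrite !mulf_eq0 invr_eq0 mulf_eq0 (negPf nzk) (negPf nzl) !orbF !subr_eq0.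
case/orP; first rewrite (eq_prim_root_expr prim_z) !modn_small => [/eqP // ||].
- by rewrite -addnn ltn_addr.
- by rewrite -addnn ltn_addr.
rewrite -exprD -(prim_order_dvd prim_z) => dv; have lt2 : (k + l < n.*2)%N.
  by have := leq_add lt_kn (ltnW lt_ln); rewrite addnn.
have [kl0|kl_gt0] := posnP (k + l)%N; last first.
  by move/(dvdn_leq kl_gt0): dv; rewrite leqNgt lt2.
by move/eqP: kl0; rewrite addn_eq0 => /andP[/eqP-> /eqP->].
Qed.

(** The n - 1 listed roots are distinct, and n - 1 is the degree of F_n. *)
Lemma fibp_prod : (0 < n)%N ->
  pZtoC (fibp n) = \prod_(x <- [seq fib_root z k | k <- iota 1 n.-1]) ('X - x%:P).
Proof.
move=> n_gt0; set rs := map _ _.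
have rangeP k : (k \in iota 1 n.-1) = (0 < k < n)%N by rewrite mem_iota add1n prednK.
have monF : pZtoC (fibp n) \is monic by rewrite -(prednK n_gt0) monic_map ?monic_fibp.
rewrite [LHS](@all_roots_prod_XsubC _ _ rs).
- by rewrite (monicP monF) scale1r.
- rewrite size_map_inj_poly ?size_fibp ?size_map ?size_iota ?prednK //.
  exact: intr_inj.
- apply/allP=> x /mapP[k]; rewrite rangeP => lt_k ->.
  by rewrite /root fib_root_rank // dvdn_div ?dvdn_gcdl.
rewrite uniq_rootsE map_inj_in_uniq ?iota_uniq // => k l; rewrite !rangeP.
by case/andP=> _ lt_k /andP[_ lt_l]; apply: fib_root_inj.
Qed.

End FibRoots.

Lemma fib_rank_uniq d e x : (0 < d)%N -> (0 < e)%N ->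
  fib_rank d x -> fib_rank e x -> d = e.
Proof.
move=> d_gt0 e_gt0 rk_d rk_e; apply/eqP; rewrite eqn_dvd.
by rewrite -rk_d rk_e dvdnn -rk_e rk_d dvdnn.
Qed.

Lemma fibp_roots n : (0 < n)%N ->
  exists rs, [/\ uniq rs, pZtoC (fibp n) = \prod_(x <- rs) ('X - x%:P)
    & forall x, x \in rs -> exists2 d, (d %| n)%N & fib_rank d x].
Proof.
move=> n_gt0; have [z prim_z] : {z : algC | n.*2.-primitive_root z}.
  by apply: C_prim_root_exists; rewrite double_gt0.
eexists; split; [|exact: (fibp_prod _ _ prim_z)|].
  rewrite map_inj_in_uniq ?iota_uniq // => k l; rewrite !mem_iota add1n prednK //.
  by case/andP=> _ lt_k /andP[_ lt_l]; apply: (fib_root_inj _ _ prim_z).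
move=> x /mapP[k]; rewrite mem_iota add1n prednK // => lt_k ->.
exists (n %/ gcdn n k)%N; last exact: (fib_root_rank _ _ prim_z).
by rewrite dvdn_div ?dvdn_gcdl.
Qed.

(** The k-th root has rank n / gcd(n, k), which is n exactly when k is coprime to n. *)
Lemma fib_rank_roots n : (1 < n)%N ->
  exists rs, [/\ uniq rs, size rs = totient n
    & forall x, x \in rs <-> fib_rank n x].
Proof.
move=> n_gt1; have n_gt0 := ltnW n_gt1.
have [z prim_z] : {z : algC | n.*2.-primitive_root z}.
  by apply: C_prim_root_exists; rewrite double_gt0.
(* Starting at 0 matches the library's count for the totient; 0 itself is filtered out because n >
   1. *)
pose ks := [seq k <- iota 0 n | coprime n k].
pose rs := [seq fib_root z k | k <- ks].
have ksP k : (k \in ks) = (coprime n k && (0 < k < n)%N).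
  rewrite mem_filter mem_iota; case: k => [|k]; last by rewrite add0n.
  by rewrite /coprime gcdn0 gtn_eqF.
have rs_uniq : uniq rs.
  rewrite map_inj_in_uniq ?filter_uniq ?iota_uniq // => k l; rewrite !ksP.
  by case/and3P=> _ _ lt_k /and3P[_ _ lt_l]; apply: (fib_root_inj _ _ prim_z).
exists rs; split=> //.
  rewrite size_map size_filter -sum1_count big_mkcond /= totient_count_coprime.
  by rewrite /index_iota subn0; apply: eq_bigr => k _; case: coprime.
move=> x; split.
  case/mapP=> k; rewrite ksP => /andP[/eqP co_nk lt_k] ->.
  by have := fib_root_rank _ _ prim_z _ lt_k; rewrite co_nk divn1.
move=> rk_x; have : root (pZtoC (fibp n)) x by rewrite /root rk_x.
rewrite (fibp_prod _ _ prim_z n_gt0) root_prod_XsubC => /mapP[k].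
rewrite mem_iota add1n prednK // => lt_k Dx; rewrite Dx map_f // ksP lt_k andbT.
have := fib_root_rank _ _ prim_z _ lt_k; rewrite -Dx => /fib_rank_uniq-/(_ n)Dn.
have g_gt0 : (0 < gcdn n k)%N by rewrite gcdn_gt0 n_gt0.
have := Dn _ n_gt0 rk_x; rewrite divn_gt0 // dvdn_leq ?dvdn_gcdl // => /(_ isT)/eqP.
rewrite -(eqn_pmul2r g_gt0) divnK ?dvdn_gcdl // -{1}[n]muln1 eqn_pmul2l //.
by rewrite eq_sym.
Qed.

(** * Integral minimal polynomials and the roots of fibotomic polynomials *)

(** The minimal polynomial over the rationals has integer coefficients because x is an algebraic
    integer. Divisibility in [{poly int}] allows a nonzero scalar factor, so it agrees with
    divisibility over the rationals. *)
Lemma minpoly_int x : x \in Aint ->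
  exists q : {poly int}, [/\ q \is monic, irreducible_poly q
    & forall P : {poly int}, (ev P x == 0) = (q %| P)].
Proof.
rewrite unfold_in => /floorpP[q Dq]; exists q.
have [p [Dp mon_p] min_p] := minCpolyP x.
have pQtoC_Z (P : {poly int}) : map_poly ratr (map_poly intr P) = pZtoC P.
  by rewrite -map_poly_comp; apply: eq_map_poly => a; rewrite /= ratr_int.
have Dpq : p = map_poly intr q.
  by apply: (map_poly_inj (ratr : rat -> algC)); rewrite -Dp pQtoC_Z.
have min_q (P : {poly int}) : (ev P x == 0) = (q %| P).
  by rewrite -[LHS]/(root _ _) -pQtoC_Z min_p Dpq dvdp_rat_int.
have szZ (P : {poly int}) : size (pZtoC P) = size P.
  by rewrite size_map_inj_poly //; apply: intr_inj.
have mon_q : q \is monic.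
  rewrite monicE -(inj_eq (intr_inj : injective (intr : int -> algC))).
  rewrite -lead_coef_map_inj ?rmorph0 //; last exact: intr_inj.
  by rewrite -Dq (monicP (minCpoly_monic x)).
have q_gt1 : (1 < size q)%N by rewrite -szZ -Dq size_minCpoly.
split=> //; split=> // r sz_r r_dv_q; rewrite /eqp r_dv_q /=.
have [[c s] /= nz_c Ds] := Pdiv.Idomain.dvdpP _ _ r_dv_q.
have nz_q : q != 0 by rewrite monic_neq0.
have nz_sr : s * r != 0 by rewrite -Ds scale_poly_eq0 negb_or nz_c.
have [nz_s nz_r] : s != 0 /\ r != 0 by apply/andP; rewrite -negb_or -mulf_eq0.
(* Either r(x) = 0 and q divides r, or s(x) = 0 and q divides s; the latter makes r constant by
   degrees, against [sz_r]. *)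
have : (ev (s * r) x == 0) by rewrite min_q -Ds dvdpZr.
rewrite rmorphM hornerM mulf_eq0 !min_q => /orP[/dvdp_leq le_qs|//].
have := congr1 (fun P : {poly int} => size P) Ds.
rewrite size_scale // size_mul // => sz_q.
case/negP: sz_r; rewrite eqn_leq size_poly_gt0 nz_r andbT.
have := le_qs nz_s; rewrite sz_q; move: nz_s nz_r; rewrite -!size_poly_gt0.
case: (size s) => // i; case: (size r) => // j _ _.
by rewrite addnS /= -{2}[i.+1]addn0 leq_add2l.
Qed.

Lemma deriv_int_neq0 (q : {poly int}) : (1 < size q)%N -> q^`() != 0.
Proof.
case Dn: (size q) => [|[|n]] // _; apply/eqP => /(congr1 (fun P : {poly int} => P`_n)).
have: lead_coef q != 0 by rewrite lead_coef_eq0 -size_poly_eq0 Dn.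
by rewrite lead_coefE Dn coef_deriv coef0 => nz /eqP; rewrite mulrn_eq0 (negPf nz).
Qed.

(* If [P] had a multiple root [x], then the minimal polynomial of [x], which is
   separable, would divide [P] twice. *)
Lemma fibotomic_prod n P : (1 < n)%N -> fibotomic n P ->
  exists rs, [/\ uniq rs, size rs = totient n, forall x, x \in rs <-> fib_rank n x
    & pZtoC P = \prod_(x <- rs) ('X - x%:P)].
Proof.
move=> n_gt1 [mon_P fibP]; have n_gt0 := ltnW n_gt1.
have [rs [rs_uniq sz_rs rsP]] := fib_rank_roots n n_gt1; exists rs; split=> //.
have monPC : pZtoC P \is monic by rewrite monic_map.
(* The definition of [fibotomic] is applied to the minimal polynomial q of x. A root of F_n has some
   rank d dividing n, and d < n would make q divide F_d. *)
have rootP x : root (pZtoC P) x = (x \in rs).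
  apply/idP/idP => [Px0|/rsP rk_x].
    have Ax : x \in Aint.
      apply: root_monic_Aint Px0 monPC _.
      by apply/polyOverP => i; rewrite coef_map /= rpred_int.
    have [q [mon_q irr_q min_q]] := minpoly_int x Ax.
    have [q_dv _] := fibP q mon_q irr_q; move: q_dv; rewrite -min_q [_ == 0]Px0.
    case/esym/andP; rewrite -min_q => Fn0 /forallP Fk.
    have [rs' [_ DF rk_rs']] := fibp_roots n n_gt0.
    have [|d d_dv_n rk_x] := rk_rs' x; first by rewrite -root_prod_XsubC -DF.
    apply/rsP; have d_gt0 := dvdn_gt0 n_gt0 d_dv_n.
    have := dvdn_leq n_gt0 d_dv_n; rewrite leq_eqVlt => /predU1P[<- //|lt_dn].
    by have := Fk (Ordinal lt_dn); rewrite /= d_gt0 -min_q rk_x dvdnn.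
  have Ax := fib_rank_Aint _ _ n_gt0 rk_x.
  have [q [mon_q irr_q min_q]] := minpoly_int x Ax.
  have [q_dv _] := fibP q mon_q irr_q.
  rewrite /root [_ == 0]min_q q_dv -min_q rk_x dvdnn; apply/forallP=> k.
  by apply/implyP=> k_gt0; rewrite -min_q rk_x gtnNdvd.
have [r Dr] := closed_field_poly_normal (pZtoC P).
rewrite (monicP monPC) scale1r in Dr; rewrite Dr; apply: perm_big.
apply: uniq_perm => // [|x]; last by rewrite -rootP Dr root_prod_XsubC.
rewrite -separable_prod_XsubC -Dr unlock; apply/Pdiv.ClosedField.coprimepP => x Px0.
rewrite deriv_map; have rk_x : fib_rank n x by apply/rsP; rewrite -rootP.
have [q [mon_q irr_q min_q]] := minpoly_int x (fib_rank_Aint _ _ n_gt0 rk_x).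
have [_ /negP sqf] := fibP q mon_q irr_q.
apply/negP; rewrite min_q => q_dv_P'; apply: sqf.
(* With P = s q, if q divides P' then it divides s q', hence s or q'; the latter is excluded by
   degrees. *)
have := Px0; rewrite /root min_q => /(Pdiv.IdomainMonic.dvdpP mon_q)[s Ds].
rewrite Ds dvdp_mul2r ?monic_neq0 //; move: q_dv_P'; rewrite Ds derivM.
rewrite dvdp_addr; last exact: dvdp_mull.
rewrite -min_q rmorphM hornerM mulf_eq0 !min_q => /orP[//|].
move/(dvdp_leq (deriv_int_neq0 q irr_q.1)).
by rewrite leqNgt lt_size_deriv ?monic_neq0.
Qed.

(** * Resultants from distinct roots, and homogenization *)

(* Multiply the Sylvester matrix by the Vandermonde matrix of all the roots. *)
Lemma resultant_distinct_roots (R : idomainType) (p q : {poly R})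
    (a : 'I_(size p).-1 -> R) (b : 'I_(size q).-1 -> R) :
    injective a -> injective b -> (forall i j, a i != b j) ->
    (forall i, p.[a i] = 0) -> (forall j, q.[b j] = 0) ->
    (forall i, q.[a i] = \prod_j (a i - b j)) ->
  resultant p q = \prod_j p.[b j].
Proof.
move=> inj_a inj_b neq_ab pa0 qb0 qa.
pose va := \row_i a i; pose vb := \row_j b j; pose x := row_mx vb va.
(* A Sylvester row lists the coefficients of ['X^k * f], so its product with the column of powers of
   y is y^k f(y). *)
have horner_shift (f : {poly R}) (k d : nat) y : (k + (size f).-1 < d)%N ->
    \sum_(j < d) f`_(j - k) *+ (k <= j)%N * y ^+ j = y ^+ k * f.[y].
  move=> lt_kd; rewrite -[y ^+ k]hornerXn -hornerM (horner_coef_wide (n := d)).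
    by apply: eq_bigr => j _; rewrite coefXnM ltnNge if_neg -mulrb.
  apply: leq_trans (size_polyMleq _ _) _; rewrite size_polyXn addSn /=.
  by move: lt_kd; case: (size f) => [|m]; rewrite ?addn0 ?addnS //; apply: ltnW.
(* With the roots of q placed first, the product matrix is block diagonal: p vanishes at each a, q
   at each b. *)
have split_det : \det (Sylvester_mx p q) * \det (Vandermonde _ x) =
    (\det (Vandermonde _ vb) * \prod_j p.[b j]) *
    (\det (Vandermonde _ va) * \prod_i q.[a i]).
  have <- : \det (diag_mx (\row_j p.[b j])) = \prod_j p.[b j].
    by rewrite det_diag; apply: eq_bigr => j _; rewrite mxE.
  have <- : \det (diag_mx (\row_i q.[a i])) = \prod_i q.[a i].
    by rewrite det_diag; apply: eq_bigr => j _; rewrite mxE.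
  rewrite -!det_mulmx -(det_ublock _ 0); congr (\det _).
  rewrite !mul_mx_diag.
  apply/matrixP=> i j; rewrite [LHS]mxE.
  under eq_bigr => k _ do rewrite Sylvester_mxE mxE.
  case: (split_ordP i) => {}i ->; case: (split_ordP j) => {}j ->;
   rewrite ?(unsplitK (inl i)) ?(unsplitK (inr i)) horner_shift ?ltn_add2r //;
   rewrite ?(block_mxEul, block_mxEur, block_mxEdl, block_mxEdr);
   rewrite /x ?(row_mxEl, row_mxEr) ?mxE ?pa0 ?qb0 ?mulr0 //.
  - by rewrite addnC ltn_add2l.
  - by rewrite addnC ltn_add2l.
(* The cross differences between the two families multiply to the product of the q(a_i), which then
   cancels from [split_det]. *)
have det_x : \det (Vandermonde _ x) = \det (Vandermonde _ vb) *
    \det (Vandermonde _ va) * \prod_i q.[a i].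
  have bE i : \prod_(j < _ | (lshift (size p).-1 i < j)%N)
      (x 0 j - x 0 (lshift (size p).-1 i)) =
      (\prod_(j < _ | (i < j)%N) (vb 0 j - vb 0 i)) * \prod_k (a k - b i).
    rewrite big_split_ord /= /x !row_mxEl; congr (_ * _).
      by apply: eq_bigr => j _; rewrite row_mxEl.
    apply: eq_big => [k|k _]; first by rewrite /= ltn_addr.
    by rewrite row_mxEr !mxE.
  have aE i : \prod_(j < _ | (rshift (size q).-1 i < j)%N)
      (x 0 j - x 0 (rshift (size q).-1 i)) =
      \prod_(j < _ | (i < j)%N) (va 0 j - va 0 i).
    rewrite big_split_ord /= big_pred0 ?mul1r => [|j]; last first.
      by rewrite ltnNge ltnW // ltn_addr.
    rewrite /x !row_mxEr; apply: eq_big => [k|k _]; first by rewrite /= ltn_add2l.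
    by rewrite row_mxEr.
  rewrite !det_Vandermonde big_split_ord /= (eq_bigr _ (fun i _ => bE i)).
  rewrite (eq_bigr _ (fun i _ => aE i)) big_split /= mulrAC; congr (_ * _).
  by rewrite exchange_big; apply: eq_bigr => i _; rewrite qa.
have det_neq0 d (f : 'I_d -> R) : injective f ->
    \det (Vandermonde d (\row_i f i)) != 0.
  move=> inj_f; rewrite det_Vandermonde; apply/prodf_neq0 => i _.
  apply/prodf_neq0 => j lt_ij; rewrite !mxE subr_eq0 (inj_eq inj_f).
  by rewrite -val_eqE gtn_eqF.
have x_neq0 : \det (Vandermonde _ x) != 0.
  rewrite det_x !mulf_neq0 ?det_neq0 //; apply/prodf_neq0 => i _.
  by rewrite qa; apply/prodf_neq0 => j _; rewrite subr_eq0.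
by apply: (mulIf x_neq0); rewrite split_det det_x; ring.
Qed.

Lemma coef_homog d (P : {poly int}) i :
  (homog d P)`_i = if (i < d.+1)%N then (P`_i)%:P * 'X^(d - i) else 0.
Proof. by rewrite coef_poly. Qed.

Lemma monic_homog d (P : {poly int}) : P \is monic -> size P = d.+1 ->
  homog d P \is monic /\ size (homog d P) = d.+1.
Proof.
move=> monP szP; have Pd : P`_d = 1 by rewrite -(monicP monP) lead_coefE szP.
have Hd : (homog d P)`_d = 1 by rewrite coef_homog ltnSn subnn expr0 mulr1 Pd.
have szH : size (homog d P) = d.+1.
  by apply: size_poly_eq; rewrite /= Pd subnn expr0 mulr1 oner_eq0.
by split=> //; rewrite monicE lead_coefE szH Hd.
Qed.

(** Here ['X] is the inner variable y: by homogeneity, each root c of P gives the root c y of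
    [homog d P]. *)
Lemma horner_homog d (P : {poly int}) (c : algC) : (size P <= d.+1)%N ->
  (map_poly pZtoC (homog d P)).[c *: 'X] = ev P c *: 'X^d.
Proof.
move=> szP; rewrite (@horner_coef_wide _ d.+1); last first.
  by rewrite (leq_trans (size_poly _ _)) // size_poly.
rewrite (@horner_coef_wide _ d.+1); last by rewrite (leq_trans (size_poly _ _)).
rewrite scaler_suml; apply: eq_bigr => i _.
rewrite !coef_map coef_homog ltn_ord /=.
rewrite -[map_poly _ (_ * _)]/(pZtoC _) rmorphM /= map_polyC map_polyXn /=.
by rewrite exprZn -!mul_polyC mulrACA -exprD subnK -1?ltnS // polyCM.
Qed.

(** Over the complex algebraic numbers the homogenized polynomials have the distinct roots c y, so
    the resultant is the product of the P(b) y^r over the roots b of Q, where r = [size rs]. *)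
Lemma resultant_homog (P Q : {poly int}) (rs ss : seq algC) :
    pZtoC P = \prod_(x <- rs) ('X - x%:P) -> pZtoC Q = \prod_(x <- ss) ('X - x%:P) ->
    uniq (rs ++ ss) ->
  pZtoC (resultant (homog (size rs) P) (homog (size ss) Q)) =
    (\prod_(y <- ss) ev P y) *: 'X^(size rs * size ss).
Proof.
move=> DP DQ; rewrite cat_uniq => /and3P[rs_uniq /hasPn disj ss_uniq].
have szZ (R : {poly int}) : size (pZtoC R) = size R.
  by rewrite size_map_inj_poly //; apply: intr_inj.
have szP : size P = (size rs).+1 by rewrite -szZ DP size_prod_XsubC.
have szQ : size Q = (size ss).+1 by rewrite -szZ DQ size_prod_XsubC.
have monZ (R : {poly int}) : pZtoC R \is monic -> R \is monic.
  rewrite !monicE lead_coef_map_inj ?rmorph0 //; last exact: intr_inj.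
  by rewrite -[1]/(1%:~R) (inj_eq intr_inj).
have monP : P \is monic by rewrite monZ // DP monic_prod_XsubC.
have monQ : Q \is monic by rewrite monZ // DQ monic_prod_XsubC.
have [monHP szHP] := monic_homog _ _ monP szP.
have [monHQ szHQ] := monic_homog _ _ monQ szQ.
rewrite map_resultant ?(monicP monHP) ?(monicP monHQ) ?rmorph1 ?oner_eq0 //.
set p := map_poly _ (homog _ P); set q := map_poly _ (homog _ Q).
have szmap (R : {poly {poly int}}) : R \is monic -> size (map_poly pZtoC R) = size R.
  by move=> monR; rewrite size_map_poly_id0 // (monicP monR) rmorph1 oner_eq0.
have szp : (size p).-1 = size rs by rewrite szmap ?szHP.
have szq : (size q).-1 = size ss by rewrite szmap ?szHQ.
have pE c : p.[c *: 'X] = ev P c *: 'X^(size rs) by rewrite horner_homog ?szP.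
have qE c : q.[c *: 'X] = ev Q c *: 'X^(size ss) by rewrite horner_homog ?szQ.
have nzX : 'X != 0 :> {poly algC} by rewrite polyX_eq0.
have scale_inj : injective (fun c : algC => c *: 'X : {poly algC}).
  move=> c d /eqP; rewrite -subr_eq0 -scalerBl scale_poly_eq0 (negPf nzX) orbF.
  by rewrite subr_eq0 => /eqP.
have lt_rs (i : 'I_(size p).-1) : (i < size rs)%N by rewrite -szp.
have lt_ss (i : 'I_(size q).-1) : (i < size ss)%N by rewrite -szq.
pose a (i : 'I_(size p).-1) : {poly algC} := rs`_i *: 'X.
pose b (i : 'I_(size q).-1) : {poly algC} := ss`_i *: 'X.
have big_ss (T : comNzRingType) (f : algC -> T) :
    \prod_(y <- ss) f y = \prod_(i < (size q).-1) f ss`_i.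
  by rewrite (big_nth 0) big_mkord szq.
rewrite (@resultant_distinct_roots _ p q a b).
- rewrite big_ss -mul_polyC rmorph_prod exprM -[X in 'X^_ ^+ X]szq.
  rewrite -[X in _ * _ ^+ X]card_ord -prodr_const -big_split /=.
  by apply: eq_bigr => j _; rewrite pE mul_polyC.
- by move=> i j /scale_inj/eqP; rewrite nth_uniq // => /eqP/val_inj.
- by move=> i j /scale_inj/eqP; rewrite nth_uniq // => /eqP/val_inj.
- move=> i j; rewrite (inj_eq scale_inj); apply: contra (disj ss`_j _) => [/eqP <-|].
    exact: mem_nth.
  exact: mem_nth.
- move=> i; rewrite pE (_ : ev P _ = 0) ?scale0r //; apply/eqP.
  by rewrite -[_ == 0]/(root _ _) DP root_prod_XsubC mem_nth.
- move=> i; rewrite qE (_ : ev Q _ = 0) ?scale0r //; apply/eqP.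
  by rewrite -[_ == 0]/(root _ _) DQ root_prod_XsubC mem_nth.
move=> i; rewrite qE DQ horner_prod big_ss -mul_polyC rmorph_prod.
rewrite -szq -[X in 'X^X]card_ord -prodr_const -big_split /=.
by apply: eq_bigr => j _; rewrite hornerXsubC mul_polyC scalerBl.
Qed.

(** * Divisibility of algebraic integers, and the sign of the product *)

(** Unless k = 0, w = c / k is a rational algebraic integer, hence an integer. *)
Lemma Aint_dvdn (k c : nat) w : w \in Aint -> k%:R * w = c%:R -> (k %| c)%N.
Proof.
move=> Aw Dc; have [k0|nz_k] := eqVneq (k%:R : algC) 0.
  by move/eqP: Dc; rewrite k0 mul0r eq_sym pnatr_eq0 => /eqP->.
rewrite -eqAmod0_nat eqAmod0 unfold_in; case: ifP => [k0|_].
  by case/negP: nz_k; exact: k0.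
by rewrite -[X in X / _]/(c%:R : algC) -Dc mulrC mulKf.
Qed.

Lemma prodr_const_seq (R : pzSemiRingType) (I : Type) (s : seq I) (c : R) :
  \prod_(i <- s) c = c ^+ size s.
Proof. by rewrite big_const_seq count_predT iter_mulr_1. Qed.

Lemma Aint_prod_mul (s : seq algC) (f g : algC -> algC) :
    (forall x, x \in s -> exists2 w, w \in Aint & f x * w = g x) ->
  exists2 w, w \in Aint & \prod_(x <- s) f x * w = \prod_(x <- s) g x.
Proof.
elim: s => [|x s IHs] fP; first by exists 1; rewrite ?rpred1 // !big_nil mulr1.
have [w Aw Dw] := fP x (mem_head x s).
have [|v Av Dv] := IHs; first by move=> y s_y; apply: fP; rewrite inE s_y orbT.
by exists (w * v); rewrite ?rpredM // !big_cons mulrACA Dw Dv.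
Qed.

Lemma ev_conj (P : {poly int}) x : ev P x^* = (ev P x)^*.
Proof.
rewrite -[RHS]horner_map -map_poly_comp; congr (_.[_]).
by apply: eq_map_poly => a; rewrite /= rmorph_int.
Qed.

(** At a real x, F_(2j+1) is at least 1 and F_(2j+2) is x times a number at least 1. So 0 is the
    only possible real root, and it is a root of F_2, which a number of rank n > 2 is not. *)
Lemma fib_rank_nreal n x : (2 < n)%N -> fib_rank n x -> x \isn't Num.real.
Proof.
move=> n_gt2 rk_x; apply/negP => Rx.
have [Fodd Feven] : (forall j, 1 <= ev (fibp j.*2.+1) x) /\
    forall j, exists2 y, 1 <= y & ev (fibp j.*2.+2) x = x * y.
  suff E j : 1 <= ev (fibp j.*2.+1) x /\ exists2 y, 1 <= y & ev (fibp j.*2.+2) x = x * y.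
    by split=> j; case: (E j).
  elim: j => [|j [IHodd [y y_ge1 Dy]]].
    rewrite fibp1 rmorph1 hornerC; split=> //; exists 1 => //.
    by rewrite fibpSS fibp1 fibp0 addr0 mulr1 map_polyX hornerX mulr1.
  have odd1 : 1 <= ev (fibp j.+1.*2.+1) x.
    rewrite doubleS fibpSS rmorphD rmorphM /= map_polyX hornerD hornerM hornerX Dy.
    rewrite mulrA -expr2 ler_wpDl // mulr_ge0 ?real_exprn_even_ge0 //.
    exact: le_trans y_ge1.
  split=> //; exists (ev (fibp j.+1.*2.+1) x + y).
    by rewrite ler_wpDr // (le_trans ler01 y_ge1).
  rewrite doubleS fibpSS rmorphD rmorphM /= map_polyX hornerD hornerM hornerX Dy.
  by rewrite mulrDr.
have Fn0 : ev (fibp n) x = 0 by apply/eqP; rewrite rk_x.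
move: Fn0 (n_gt2); rewrite -{1 2}(odd_double_half n); case: (odd n) => /=.
  by move=> Fn0; have := Fodd n./2; rewrite -add1n Fn0 ler10.
rewrite add0n; case Dn2: n./2 => [|j] //; rewrite doubleS.
have [y y_ge1 ->] := Feven j; move/eqP; rewrite mulf_eq0 [y == 0]gt_eqF ?orbF; last first.
  exact: lt_le_trans y_ge1.
move/eqP=> x0 _; have := rk_x 2; rewrite fibpSS fibp1 fibp0 addr0 mulr1 map_polyX.
by rewrite hornerX x0 eqxx => /esym/dvdn_leq -/(_ isT); rewrite leqNgt n_gt2.
Qed.

(** Conjugation preserves the rank and has no fixed point here, so the product over the upper half
    plane is multiplied by its own conjugate. *)
Lemma prod_ev_fib_rank_ge0 n (P : {poly int}) (ss : seq algC) : (2 < n)%N ->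
    uniq ss -> (forall x, x \in ss <-> fib_rank n x) ->
  0 <= \prod_(y <- ss) ev P y.
Proof.
move=> n_gt2 ss_uniq ssP.
have nreal y : y \in ss -> 'Im y != 0.
  move/ssP/(fib_rank_nreal n y n_gt2); apply: contra => /eqP Im0.
  by apply/Creal_ImP.
have perm_conj : perm_eq ss [seq y^* | y <- ss].
  apply: uniq_perm => //; first by rewrite map_inj_uniq //; apply: fmorph_inj.
  have ss_conj y : y \in ss -> y^* \in ss.
    by move/ssP=> rk_y; apply/ssP => j; rewrite ev_conj conjC_eq0.
  move=> y; apply/idP/mapP => [ss_y|[x ss_x ->]]; last exact: ss_conj.
  by exists y^*; rewrite ?conjCK ?ss_conj.
rewrite (bigID (fun y => 0 < 'Im y)) /= [X in _ * X](perm_big _ perm_conj) big_map.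
rewrite [X in _ * X](_ : _ = (\prod_(y <- ss | 0 < 'Im y) ev P y)^*) ?mul_conjC_ge0 //.
rewrite rmorph_prod big_seq_cond [RHS]big_seq_cond.
apply: eq_big => [y|y _]; last exact: ev_conj.
have [/nreal nz_y|//] := boolP (y \in ss); rewrite /= Im_conj oppr_gt0.
by rewrite -real_leNgt ?le_eqVlt ?real0 ?Creal_Im // eq_sym (negPf nz_y).
Qed.

(** * Prime valuations of m and n, and the case n = m p^k *)

Lemma neq_logn m n : (0 < m)%N -> (0 < n)%N -> m <> n ->
  exists2 p, prime p & logn p m != logn p n.
Proof.
move=> m_gt0 n_gt0 neq_mn.
have [/hasP[p _ neq_p]|/hasPn eq_log] :=
  boolP (has (fun p => logn p m != logn p n) (primes m ++ primes n)).
  exists p => //; apply: contraLR neq_p => /negPf p'p.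
  by rewrite negbK [logn p m]lognE [logn p n]lognE p'p.
case: neq_mn; apply: eqn_from_log => // p; apply/eqP.
have [p_in|] := boolP (p \in primes m ++ primes n).
  by have := eq_log p p_in; rewrite negbK.
by rewrite mem_cat negb_or -!logn_gt0 -!leqNgt !leqn0 => /andP[/eqP-> /eqP->].
Qed.

(** Let p be a prime at which m and n differ, with exponents b in m and a in n. Then n p^b and m p^a
    agree at p; they are not equal, as n / m would be a power of p, so they differ at some other
    prime q. *)
Lemma two_neq_logn m n : (0 < m)%N -> (m < n)%N ->
    (forall p a, prime p -> (0 < a)%N -> n <> (m * p ^ a)%N) ->
  exists p q, [/\ prime p, prime q, p != q, logn p n != logn p m
    & logn q n != logn q m].
Proof.
move=> m_gt0 lt_mn not_pow; have n_gt0 := leq_ltn_trans (leq0n m) lt_mn.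
have neq_nm : n <> m by move=> Dn; rewrite Dn ltnn in lt_mn.
have [p p_pr neq_p] := neq_logn _ _ n_gt0 m_gt0 neq_nm.
pose a := logn p n; pose b := logn p m.
have pX_gt0 i : (0 < p ^ i)%N by rewrite expn_gt0 prime_gt0.
have neq_nm' : (n * p ^ b)%N <> (m * p ^ a)%N.
  move=> E; have [lt_ba|le_ab] := ltnP b a.
    apply: (not_pow p (a - b)%N p_pr); first by rewrite subn_gt0.
    apply/eqP; rewrite -(eqn_pmul2r (pX_gt0 b)) -mulnA -expnD subnK ?(ltnW lt_ba) //.
    exact/eqP.
  suff: (n * p ^ a <= m * p ^ a)%N by rewrite leq_pmul2r // leqNgt lt_mn.
  by rewrite -E leq_mul2l leq_exp2l ?prime_gt1 // le_ab orbT.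
have [||q q_pr] := neq_logn _ _ _ _ neq_nm'; rewrite ?muln_gt0 ?pX_gt0 ?n_gt0 ?m_gt0 //.
rewrite !lognM // => neq_q; exists p, q.
have neq_pq : p != q.
  by apply: contraNneq neq_q => <-; rewrite !pfactorK // addnC.
split=> //; move: neq_q.
have co i : logn q (p ^ i) = 0.
  by rewrite lognX logn_prime // eq_sym (negPf neq_pq) muln0.
by rewrite !co !addn0.
Qed.

(* [ev (fibp n) a / ev (fibp (n / p)) a] is [p] up to a unit; it is the product
   of the [a - x] over the roots [x] of [F_n] that are not roots of [F_(n/p)],
   and those of rank other than [n] only contribute units. *)
Lemma prod_fib_rank_assoc m n p k a (ss : seq algC) : (0 < m)%N -> prime p ->
    (0 < k)%N -> n = (m * p ^ k)%N -> fib_rank m a ->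
    uniq ss -> (forall x, x \in ss <-> fib_rank n x) ->
  (exists2 w, w \in Aint & (\prod_(x <- ss) (a - x)) * w = p%:R) /\
  (exists2 w, w \in Aint & p%:R * w = \prod_(x <- ss) (a - x)).
Proof.
move=> m_gt0 p_pr k_gt0 Dn rk_a ss_uniq ssP; pose l := (m * p ^ k.-1)%N.
have p_gt0 := prime_gt0 p_pr; have Aa := fib_rank_Aint _ _ m_gt0 rk_a.
have pX_gt0 i : (0 < p ^ i)%N by rewrite expn_gt0 p_gt0.
have n_gt0 : (0 < n)%N by rewrite Dn muln_gt0 m_gt0 pX_gt0.
have l_gt0 : (0 < l)%N by rewrite muln_gt0 m_gt0 pX_gt0.
have Dpl : n = (p * l)%N by rewrite Dn /l mulnCA -expnS prednK.
have l_dv_n : (l %| n)%N by rewrite Dpl dvdn_mull.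
have Fl0 : ev (fibp l) a = 0 by apply/eqP; rewrite rk_a dvdn_mulr.
(* Since m divides l = n / p, F_l(a) = 0, and the congruences modulo F_l become equalities at a. *)
have [Q [U [V [r [s [DF UQ DQ]]]]]] := fibp_quo_mod l p.
have nat_ev (c : nat) : ev (c%:R) a = c%:R by rewrite rmorph_nat -polyC_natr hornerC.
have UQa : ev U a * ev Q a = p%:R.
  move/(congr1 (fun P => ev P a)): UQ.
  by rewrite rmorphM rmorphD rmorphM !(hornerM, hornerD) nat_ev Fl0 mul0r addr0.
have Qa : ev Q a = p%:R * ev V a.
  by rewrite {1}DQ rmorphD !rmorphM !(hornerM, hornerD) nat_ev Fl0 mul0r addr0.
have [rs [rs_uniq DFn rk_rs]] := fibp_roots n n_gt0.
have [ts [ts_uniq DFl rk_ts]] := fibp_roots l l_gt0.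
have rsP x : (x \in rs) = (ev (fibp n) x == 0) by rewrite -root_prod_XsubC -DFn.
have tsP x : (x \in ts) = (ev (fibp l) x == 0) by rewrite -root_prod_XsubC -DFl.
(* The roots of F_n are simple and include those of F_l, so Q keeps exactly the others. *)
have DQr : pZtoC Q = \prod_(x <- rs | x \notin ts) ('X - x%:P).
  have nzFl : pZtoC (fibp l) != 0 by rewrite monic_neq0 // DFl monic_prod_XsubC.
  apply: (mulfI nzFl); rewrite -rmorphM /= -DF -Dpl DFn (bigID (mem ts)) /= DFl.
  congr (_ * _); rewrite -big_filter; apply: perm_big; apply: uniq_perm => //.
    exact: filter_uniq.
  move=> x; rewrite mem_filter andb_idr // tsP rsP => Flx0.
  have [R DR] := fibp_dvd_mul l p.
  by rewrite Dpl DR rmorphM hornerM (eqP Flx0) mul0r.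
have rk_n x : fib_rank n x -> (x \in rs) && (x \notin ts).
  move=> rk_x; rewrite rsP tsP !rk_x dvdnn gtnNdvd // Dpl.
  by rewrite -{1}[l]mul1n ltn_pmul2r ?prime_gt1.
pose es := [seq x <- rs | (x \notin ts) && (x \notin ss)].
pose E := \prod_(x <- es) (a - x).
have QE : ev Q a = \prod_(x <- ss) (a - x) * E.
  rewrite DQr horner_prod (bigID (mem ss)) /E big_filter /=; congr (_ * _).
    rewrite -big_filter; under eq_bigr => x _ do rewrite hornerXsubC.
    apply: perm_big; apply: uniq_perm => //; first exact: filter_uniq.
    move=> x; rewrite mem_filter -andbA andbCA [(x \notin ts) && _]andbC andb_idr //.
    by move/ssP/rk_n.
  by apply: eq_bigr => x _; rewrite hornerXsubC.
have Ars x : x \in rs -> x \in Aint.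
  by move=> /rk_rs[d d_dv_n]; apply: fib_rank_Aint; apply: dvdn_gt0 d_dv_n.
have AE : E \in Aint.
  rewrite /E big_seq rpred_prod // => x; rewrite mem_filter => /andP[_ /Ars Ax].
  exact: rpredB.
(* The rank d of such an x divides n but not n / p, so d and n have the same exponent at p, which
   exceeds that of m by k. As d differs from n, it differs at another prime q, where n and m agree.
   Thus d and m differ at both p and q, and a - x is a unit. *)
have [w Aw Ew] : exists2 w, w \in Aint & E * w = 1.
  have [x|w Aw Ew] := Aint_prod_mul es (fun x => a - x) (fun=> 1); last first.
    by exists w; rewrite // Ew big1_eq.
  rewrite mem_filter => /andP[/andP[ts'x ss'x] /rk_rs].
  case=> d d_dv_n rk_x; have d_gt0 := dvdn_gt0 n_gt0 d_dv_n.
  have neq_dn : d <> n by move=> Ed; case/negP: ss'x; apply/ssP; rewrite -Ed.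
  have logm : (logn p n = logn p m + k)%N by rewrite Dn lognM // pfactorK.
  have log_pd : logn p d = logn p n.
    apply/eqP; rewrite eqn_leq dvdn_leq_log // leqNgt; apply: contra ts'x => lt_dn.
    have [_] := dvdn_gcd_divp _ _ _ d_gt0 p_pr lt_dn.
    by rewrite (gcdn_idPr d_dv_n) Dpl mulKn // tsP rk_x.
  have [q q_pr neq_q] := neq_logn _ _ d_gt0 n_gt0 neq_dn.
  have neq_pq : p != q by apply: contraNneq neq_q => <-; rewrite log_pd.
  apply: (fib_rank_sub_unit m d a x p q) => //.
    by rewrite log_pd logm -{2}[logn p m]addn0 eqn_add2l -lt0n.
  apply: contra neq_q => /eqP ->; rewrite Dn lognM // lognX (logn_prime q p_pr).
  by rewrite [q == p]eq_sym (negPf neq_pq) muln0 addn0.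
split; first by exists (E * ev U a); rewrite ?rpredM ?Aint_evZ // mulrA -QE mulrC.
exists (ev V a * w); first by rewrite rpredM ?Aint_evZ.
by rewrite mulrA -Qa QE -mulrA Ew mulr1.
Qed.

(** * Evaluation of the resultant *)

Theorem theorem2 (m n : nat) (Pm Pn : {poly int}) :
  (2 <= m)%N -> (m < n)%N -> fibotomic m Pm -> fibotomic n Pn ->
  (forall (p a : nat), prime p -> (0 < a)%N -> n = (m * p ^ a)%N ->
     resultant (homog (totient m) Pm) (homog (totient n) Pn)
       = ((p ^ totient m)%N%:R)%:P * 'X^(totient m * totient n))
  /\
  ((forall (p a : nat), prime p -> (0 < a)%N -> n <> (m * p ^ a)%N) ->
     resultant (homog (totient m) Pm) (homog (totient n) Pn)
       = 'X^(totient m * totient n)).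
Proof.
move=> m_gt1 lt_mn fibm fibn; have m_gt0 := ltnW m_gt1.
have n_gt0 := ltn_trans m_gt0 lt_mn; have n_gt2 := leq_ltn_trans m_gt1 lt_mn.
have [rs [rs_uniq sz_rs rsP DPm]] := fibotomic_prod m Pm m_gt1 fibm.
have [ss [ss_uniq sz_ss ssP DPn]] := fibotomic_prod n Pn (ltnW n_gt2) fibn.
have uniq_all : uniq (rs ++ ss).
  rewrite cat_uniq rs_uniq ss_uniq andbT; apply/hasPn => x /ssP rk_n.
  apply/negP => /rsP rk_m; have := fib_rank_uniq _ _ _ m_gt0 n_gt0 rk_m rk_n.
  by move=> E; rewrite E ltnn in lt_mn.
have := resultant_homog Pm Pn rs ss DPm DPn uniq_all; rewrite sz_rs sz_ss.
set res := resultant _ _; set N := \prod_(y <- ss) _; set e := (_ * _)%N => Dres.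
have DN : N = \prod_(y <- ss) \prod_(x <- rs) (y - x).
  apply: eq_bigr => y _; rewrite DPm horner_prod.
  by apply: eq_bigr => x _; rewrite hornerXsubC.
(* N is the coefficient of y^e in a resultant with integer coefficients. *)
have [c Nc] : exists c : int, N = c%:~R.
  exists res`_e; move/(congr1 (fun P : {poly algC} => P`_e)): Dres.
  by rewrite coef_map coefZ coefXn eqxx mulr1.
(* Regrouping by the roots x of rank m turns each y - x into x - y, at the cost of one sign per
   y. *)
have DN' : N = \prod_(x <- rs) ((-1) ^+ size ss * \prod_(y <- ss) (x - y)).
  rewrite DN exchange_big; apply: eq_bigr => x _; rewrite -prodr_const_seq -big_split.
  by apply: eq_bigr => y _; rewrite /= mulN1r opprB.
have prod_const (d : algC) : \prod_(x <- rs) d = d ^+ totient m.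
  by rewrite prodr_const_seq sz_rs.
have [k Nk] : exists k : nat, N = k%:R.
  have := prod_ev_fib_rank_ge0 n Pm ss n_gt2 ss_uniq ssP; rewrite -/N Nc ler0z.
  by case: c {Nc} => // k _; exists k.
have resE : res = (k%:R)%:P * 'X^e.
  apply: (map_inj_poly (intr_inj : injective (intr : int -> algC))); first exact: rmorph0.
  by rewrite Dres rmorphM /= map_polyXn map_polyC /= Nk rmorph_nat mul_polyC.
split=> [p a p_pr a_gt0 Dn | not_pow].
  rewrite resE; congr ((_%:R)%:P * _); apply/eqP.
  have assoc x : x \in rs -> _ := fun rs_x => prod_fib_rank_assoc m n p a x ss
    m_gt0 p_pr a_gt0 Dn (proj1 (rsP x) rs_x) ss_uniq ssP.
  have sgn2 : (-1) ^+ size ss * (-1) ^+ size ss = 1 :> algC by rewrite -expr2 sqrr_sign.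
  (* For each x, the product of the x - y is p up to a unit. Over the totient(m) values of x this
     gives divisibility both ways between k and p^totient(m), and natural numbers leave no sign
     ambiguity. *)
  rewrite eqn_dvd; apply/andP; split.
    have [x rs_x|w Aw] := Aint_prod_mul rs
        (fun x => (-1) ^+ size ss * \prod_(y <- ss) (x - y)) (fun=> p%:R).
      have [[w Aw Dw] _] := assoc x rs_x; exists ((-1) ^+ size ss * w).
        by rewrite rpredM ?rpredX ?rpredN ?rpred1.
      by rewrite mulrACA sgn2 mul1r.
    by rewrite -DN' Nk prod_const -natrX; apply: Aint_dvdn.
  have [x rs_x|w Aw] := Aint_prod_mul rs (fun=> p%:R)
      (fun x => (-1) ^+ size ss * \prod_(y <- ss) (x - y)).
    have [_ [w Aw Dw]] := assoc x rs_x; exists ((-1) ^+ size ss * w).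
      by rewrite rpredM ?rpredX ?rpredN ?rpred1.
    by rewrite mulrCA Dw.
  by rewrite -DN' Nk prod_const -natrX; apply: Aint_dvdn.
(* Two primes separate m from n, so every x - y is a unit and k divides 1. *)
have [p [q [p_pr q_pr neq_pq log_p log_q]]] := two_neq_logn m n m_gt0 lt_mn not_pow.
have [x rs_x|w Aw] := Aint_prod_mul rs
    (fun x => (-1) ^+ size ss * \prod_(y <- ss) (x - y)) (fun=> 1).
  have [y ss_y|w Aw Dw] := Aint_prod_mul ss (fun y => x - y) (fun=> 1).
    apply: (fib_rank_sub_unit m n x y p q) => //; [exact/rsP | exact/ssP].
  exists ((-1) ^+ size ss * w); first by rewrite rpredM ?rpredX ?rpredN ?rpred1.
  by rewrite mulrACA -expr2 sqrr_sign mul1r Dw big1_eq.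
rewrite -DN' Nk big1_eq => /(Aint_dvdn k 1 _ Aw); rewrite dvdn1 => /eqP k1.
by rewrite resE k1 mul1r.
Qed.
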